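(* Let $F$ and $G$ be probability distributions on $\mathbb{R}^d$ with $G$ absolutely continuous with respect to $F$, and let $l=\sqrt{\mathrm{d}G/\mathrm{d}F}$. Let $q_0=1,q_1,\dots,q_\kappa$ be orthonormal in $L_2(F)$ and let $r_0=1,r_1,\dots,r_\kappa$ be orthonormal in $L_2(G)$. Assume that the $2\kappa+2$ functions $q_0,\dots,q_\kappa,l,lr_1,\dots,lr_\kappa$ are linearly independent in $L_2(F)$, let $\hat{\mathcal L}\subset L_2(F)$ be their linear span, and let $(a_i)_{0\le i\le 2\kappa+1}$ and $(b_i)_{0\le i\le 2\kappa+1}$ be orthonormal bases of $\hat{\mathcal L}$ (for $\langle\cdot,\cdot\rangle_F$) with $a_i=q_i$ and $b_i=lr_i$ for $0\le i\le\kappa$, the remaining elements being arbitrary. Define the operator $\hat K$ on $L_2(F)$ by $$\hat K=I_{\hat{\mathcal L}\perp}+\sum_{i=0}^{2\kappa+1}a_i\langle b_i,\cdot\rangle_F ,$$ where $I_{\hat{\mathcal L}\perp}$ is the orthogonal projector onto the orthogonal complement of $\hat{\mathcal L}$ in $L_2(F)$. If $\hat v_F$ is a $q$-projected $F$-Brownian motion, then $$\hat v_G(\psi)=\hat v_F\bigl(\hat K(l\psi)\bigr),\qquad \psi\in L_2(G),$$ or, more explicitly, $$\hat v_G(\psi)=\hat v_F(l\psi)-\sum_{i=\kappa+1}^{2\kappa+1}\hat v_F(a_i)\,\langle l\psi,a_i-b_i\rangle_F ,$$ is an $r$-projected $G$-Brownian motion. If $G$ and $F$ are equivalent (mutually absolutely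 continuous), then this transformation $\hat v_F\mapsto\hat v_G$ is one-to-one.
   Context: For a probability distribution $F$ on $\mathbb{R}^d$, write $\langle\phi,\tilde\phi\rangle_F=\int\phi\tilde\phi\,\mathrm{d}F$. An $F$-Brownian motion $w_F$ is a family of centered jointly Gaussian random variables $w_F(\phi)$, $\phi\in L_2(F)$, (a.s.) linear in $\phi$, with $E\,w_F(\phi)w_F(\tilde\phi)=\langle\phi,\tilde\phi\rangle_F$. Given orthonormal functions $q_0=1,q_1,\dots,q_\kappa$ in $L_2(F)$, a $q$-projected $F$-Brownian motion is a family distributed as $$\hat v_F(\phi)=w_F(\phi)-\sum_{i=0}^\kappa\langle q_i,\phi\rangle_F\,w_F(q_i),\qquad \phi\in L_2(F);$$ equivalently, it is linear, centered Gaussian with covariance $\langle\phi,\tilde\phi\rangle_F-\sum_{i=0}^\kappa\langle q_i,\phi\rangle_F\langle q_i,\tilde\phi\rangle_F$. An $r$-projected $G$-Brownian motion is defined in the same way with $G$ and $r_0,\dots,r_\kappa$ in place of $F$ and $q_0,\dots,q_\kappa$. (In the statistical application $F=F_\theta$ belongs to a parametric family and $(q_1,\dots,q_\kappa)^T$ is its normalized score function.) Note that $l\psi\in L_2(F)$ for $\psi\in L_2(G)$. ''One-to-one'' means that $\hat v_F$ can be recovered from $\hat v_G$: the formula defines an injective map on the set of linear maps $v$ from $L_2(F)$ to (a.s. classes of) random variables satisfying $v(q_0)=\dots=v(q_\kappa)=0$ (a property every $q$-projected $F$-Brownian motion has). *)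

(* Defs.v *)
From HB Require Import structures.
From mathcomp Require Import all_boot all_order all_algebra.
From mathcomp Require Import all_classical all_reals all_analysis.
From mathcomp Require Import measurable_realfun.
Import Order.TTheory GRing.Theory Num.Theory.
Import numFieldNormedType.Exports.

Set Implicit Arguments.
Unset Strict Implicit.
Unset Printing Implicit Defensive.

Local Open Scope classical_set_scope.
Local Open Scope ring_scope.

(* L_2(F) is represented by its square-integrable functions, i.e. by the
   library's lmodType [LfunType F _] before quotienting; an equality between
   elements of L_2(F) is therefore always written [%[ae F]], and similarly
   almost sure equality of random variables is written [%[ae P]]. *)
Definition L2 {d} {T : measurableType d} {R : realType}
  (F : probability T R) := LfunType F (lee1n 2 : (1 <= 2%:R%:E)%E).

Section L2_theory.
Context {d} {T : measurableType d} {R : realType} (F : probability T R).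
Implicit Types (phi psi : L2 F) (M : set (L2 F)).

Definition inner phi psi : R := (\int[F]_x (phi x * psi x))%R.

Definition L2_orthonormal n (e : 'I_n -> L2 F) :=
  forall i j, inner (e i) (e j) = (i == j)%:R.

Definition lin_indep n (u : 'I_n -> L2 F) :=
  forall c : 'I_n -> R,
    (\sum_(i < n) c i *: u i : L2 F) = cst 0 %[ae F] -> forall i, c i = 0.

Definition lspan n (u : 'I_n -> L2 F) : set (L2 F) :=
  [set phi | exists c : 'I_n -> R,
     phi = (\sum_(i < n) c i *: u i : L2 F) %[ae F]].

Definition L2_orthonormal_basis n (e : 'I_n -> L2 F) M :=
  L2_orthonormal e /\ lspan e = M.

Definition orth_compl M : set (L2 F) :=
  [set phi | forall m, M m -> inner m phi = 0].

(* The orthogonal projector onto a closed subspace M: the element p of M with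
   phi - p orthogonal to M. It is determined F-almost everywhere, and [xget]
   selects a representative. *)
Definition orth_proj M phi : L2 F :=
  xget 0 [set p | M p /\ forall m, M m -> inner m (phi - p) = 0].

End L2_theory.

Section sqrt_density.
Context {d} {T : measurableType d} {R : realType} (F G : probability T R).

Definition sqrt_density (x : T) : R :=
  Num.sqrt (fine (Radon_Nikodym (charge_of_finite_measure G) F x)).

Lemma sqrt_density_mul_L2 (GF : G `<< F) (psi : L2 G) :
  (fun x => sqrt_density x * psi x) \in Lfun F 2%:E.
Proof.
have mRN := measurable_int F (Radon_Nikodym_integrable (nu := charge_of_finite_measure G) GF).
have ml : measurable_fun setT sqrt_density.
  apply: (measurableT_comp (f := @Num.sqrt R)).
    apply: continuous_measurable_fun; exact: sqrt_continuous.
  by apply: (measurableT_comp _ mRN); exact: fine_measurable.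
have mlp : measurable_fun setT (fun x => sqrt_density x * psi x).
  exact: measurable_funM.
have psi2 : G.-integrable setT (EFin \o (fun x => psi x ^+ 2)).
  exact/Lfun2_integrable_sqr/LfunP.
apply/andP; split; first by rewrite inE.
rewrite inE/= /finite_norm unlock poweR_lty//.
have fi := Radon_Nikodym_SigmaFinite.integrableM GF
  (fun x => (sqr_ge0 (psi x) : (0 <= (psi x ^+ 2)%:E)%E)) measurableT psi2.
have /integrableP[mf fin] := fi.
apply: le_lt_trans fin; rewrite le_eqVlt; apply/orP; left; apply/eqP.
apply: ae_eq_integral => //.
- apply/measurable_EFinP => /=.
  apply: (measurableT_comp (f := fun x : R => x `^ 2)) => //.
  exact: measurableT_comp.
- exact: measurableT_comp.
have := ae_eq_Radon_Nikodym_SigmaFinite GF measurableT.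
apply: filterS => x /(_ I) /= e _.
rewrite /sqrt_density -e.
have f0 := Radon_Nikodym_SigmaFinite.f_ge0 GF x.
have ff := Radon_Nikodym_SigmaFinite.f_fin_num GF x.
rewrite gee0_abs ?mule_ge0 ?lee_fin ?sqr_ge0//.
rewrite -[in RHS](fineK ff) -EFinM; congr EFin.
rewrite powR_mulrn// real_normK ?num_real// exprMn sqr_sqrtr ?fine_ge0//.
exact: mulrC.
Qed.

Definition density_mul (GF : G `<< F) (psi : L2 G) : L2 F :=
  Lfun_Sub (lee1n 2) (sqrt_density_mul_L2 GF psi).

End sqrt_density.

Section processes.
Context {R : realType}.

(* Dirac masses are Gaussian laws with variance 0; they have to be listed apart
   because [normal_prob m 0] is not a Dirac mass in the library. *)
Definition gaussian_law (mu : set R -> \bar R) :=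
  exists m s : R,
    (s != 0 /\ forall A, measurable A -> mu A = normal_prob m s A) \/
    (forall A, measurable A -> mu A = \d_m A).

Context {dO} {O : measurableType dO} (P : probability O R).

Definition jointly_gaussian (I : Type) (X : I -> {RV P >-> R}) :=
  forall (n : nat) (i : 'I_n -> I) (c : 'I_n -> R),
    gaussian_law
      (distribution P (\sum_(k < n) c k *: (X (i k) : {mfun O >-> R}))).

Context {d} {T : measurableType d} (F : probability T R).

(* A linear map from L_2(F) to almost sure classes of random variables. The
   first clause says that it is well defined on F-a.e. classes. *)
Definition L2_linear (v : L2 F -> {RV P >-> R}) :=
  (forall phi psi : L2 F, phi = psi %[ae F] -> v phi = v psi %[ae P]) /\
  (forall (a : R) (phi psi : L2 F),
     v (a *: phi + psi) =
       (a *: (v phi : {mfun O >-> R}) + v psi : {mfun O >-> R}) %[ae P]).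

Definition brownian_motion (w : L2 F -> {RV P >-> R}) :=
  [/\ jointly_gaussian w,
      forall phi, ('E_P[w phi] = 0)%E,
      L2_linear w &
      forall phi psi, ('E_P[w phi \* w psi] = (inner phi psi)%:E)%E].

Definition projection n (q : 'I_n -> L2 F) (w : L2 F -> {RV P >-> R})
    (phi : L2 F) : {RV P >-> R} :=
  (w phi : {mfun O >-> R}) -
    \sum_(i < n) inner (q i) phi *: (w (q i) : {mfun O >-> R}).

End processes.

Definition same_fdd {R : realType} {d1} {O1 : measurableType d1}
    {d2} {O2 : measurableType d2} (P1 : probability O1 R)
    (P2 : probability O2 R) (I : Type)
    (X1 : I -> {RV P1 >-> R}) (X2 : I -> {RV P2 >-> R}) :=
  forall (n : nat) (i : 'I_n -> I) (A : set (n.-tuple R)), measurable A ->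
    P1 [set o | A [tuple X1 (i k) o | k < n]] =
    P2 [set o | A [tuple X2 (i k) o | k < n]].

Section projected.
Context {R : realType} {d} {T : measurableType d} (F : probability T R).

(* [v] is distributed as the projection of an F-Brownian motion, which may live
   on another probability space. *)
Definition projected_brownian_motion n (q : 'I_n -> L2 F)
    {dO} {O : measurableType dO} (P : probability O R)
    (v : L2 F -> {RV P >-> R}) :=
  exists (dO' : measure_display) (O' : measurableType dO')
    (P' : probability O' R) (w : L2 F -> {RV P' >-> R}),
    brownian_motion w /\ same_fdd v (projection q w).

Definition Khat n (M : set (L2 F)) (a b : 'I_n -> L2 F) (phi : L2 F) : L2 F :=
  orth_proj (orth_compl M) phi + \sum_(i < n) inner (b i) phi *: a i.

Context (G : probability T R) (GF : G `<< F).

(* The 2k functions q_0, ..., q_(k-1), l r_0, ..., l r_(k-1). *)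
Definition joint_family k (q : 'I_k -> L2 F) (r : 'I_k -> L2 G)
    (i : 'I_(k + k)) : L2 F :=
  match fintype.split i with inl j => q j | inr j => density_mul GF (r j) end.

Context {dO} {O : measurableType dO} (P : probability O R).

Definition transform n (M : set (L2 F)) (a b : 'I_n -> L2 F)
    (v : L2 F -> {RV P >-> R}) (psi : L2 G) : {RV P >-> R} :=
  v (Khat M a b (density_mul GF psi)).

Definition explicit_transform k (a b : 'I_(k + k) -> L2 F)
    (v : L2 F -> {RV P >-> R}) (psi : L2 G) : {RV P >-> R} :=
  (v (density_mul GF psi) : {mfun O >-> R}) -
    \sum_(j < k)
      inner (density_mul GF psi) (a (rshift k j) - b (rshift k j)) *:
        (v (a (rshift k j)) : {mfun O >-> R}).

(* Membership in the domain on which the transformation is one-to-one. *)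
Definition pinned_linear n (q : 'I_n -> L2 F) (v : L2 F -> {RV P >-> R}) :=
  L2_linear v /\ forall i, v (q i) = cst 0 %[ae P].

End projected.

(* Main.v *)
Require Import Defs.
From HB Require Import structures.
From mathcomp Require Import all_boot all_order all_algebra.
From mathcomp Require Import all_classical all_reals all_analysis.
From mathcomp Require Import ring lra measurable_realfun.
Import Order.TTheory GRing.Theory Num.Theory.
Import numFieldNormedType.Exports.

Set Implicit Arguments.
Unset Strict Implicit.
Unset Printing Implicit Defensive.

Local Open Scope classical_set_scope.
Local Open Scope ring_scope.

(** Why the theorem holds.  Let [l] be the square root of the density of [G]
    with respect to [F].  Multiplication by [l] is an isometry from [L_2(G)]
    to [L_2(F)] ([density_mul_isometry]), and [Khat] is the isometry of
    [L_2(F)] that turns [b_i] into [a_i] and fixes the orthogonal complement of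
    their common span ([Khat_isometry], [Khat_basis]).  The composite
    [U psi = Khat (l psi)] is therefore an isometry from [L_2(G)] to [L_2(F)],
    and it sends [r_i] to [q_i], since [l r_i = b_i] and [a_i = q_i].

    An isometry transports everything that defines a projected Brownian
    motion.  If [w] is an [F]-Brownian motion then [w o U] has the covariance
    of a [G]-Brownian motion; and since [<q_i, U psi>] equals [<r_i, psi>] and
    [w (q_i)] equals [w (U r_i)], evaluating the [q]-projection of [w] at
    [U psi] is the same as evaluating the [r]-projection of [w o U] at [psi]
    ([projected_brownian_transport]).

    For the explicit formula, the residuals of [phi] with respect to [a] and
    to [b] are the same projection, which gives
    [Khat phi = phi - sum_i <a_i - b_i, phi> a_i] ([Khat_explicit]).  A
    projected Brownian motion is almost surely linear and vanishes on the
    [q_i]; both are statements about finitely many coordinates, so they pass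
    from the projection of [w] to any process with the same finite-dimensional
    laws ([same_fdd_pinned]).  Applying the process to the formula for [Khat]
    removes the terms with [a_i = q_i].

    For injectivity, exchanging [a] and [b] inverts [Khat] ([Khat_cancel]), and
    when [F] is dominated by [G] the function [l] is nonzero [F]-almost
    everywhere, so that division by [l] makes multiplication by [l] onto
    ([density_mul_surj]).  Hence every [phi] is [U psi] for some [psi], and the
    transformed process determines the original one. *)

(** * The inner product of square-integrable functions *)

Section L2_inner.
Context {d} {T : measurableType d} {R : realType} (F : probability T R).
Implicit Types (phi psi chi : L2 F).

Lemma L2DE phi psi x : (phi + psi) x = phi x + psi x.
Proof. by []. Qed.

Lemma L2BE phi psi x : (phi - psi) x = phi x - psi x.
Proof. by []. Qed.

Lemma L2PE (a : R) phi psi x : (a *: phi + psi) x = a * phi x + psi x.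
Proof. by []. Qed.

Lemma L2_sumE n (c : 'I_n -> R) (u : 'I_n -> L2 F) x :
  (\sum_(i < n) c i *: u i : L2 F) x = \sum_(i < n) c i * u i x.
Proof. by elim/big_rec2: _ => // i y s _ <-. Qed.

Lemma inner_integrable phi psi :
  F.-integrable setT (EFin \o (fun x => phi x * psi x)).
Proof. by apply/Lfun1_integrable/Lfun2_mul_Lfun1; exact: LfunP. Qed.

Lemma innerC phi psi : inner phi psi = inner psi phi.
Proof. by apply: eq_Rintegral => x _; rewrite mulrC. Qed.

Lemma innerPr phi (a : R) psi chi :
  inner phi (a *: psi + chi) = a * inner phi psi + inner phi chi.
Proof.
rewrite /inner -RintegralZl//; last exact: inner_integrable.
rewrite -RintegralD//.
- by apply: eq_Rintegral => x _ /=; rewrite mulrDr mulrCA.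
- have := inner_integrable phi (a *: psi).
  by congr (_.-integrable _ _); apply/funext => x /=; rewrite mulrCA.
- exact: inner_integrable.
Qed.

Lemma innerr0 phi : inner phi 0 = 0.
Proof.
have := innerPr phi (-1) 0 0; rewrite scaleN1r addNr; lra.
Qed.

Lemma innerDr phi psi chi : inner phi (psi + chi) = inner phi psi + inner phi chi.
Proof. by have := innerPr phi 1 psi chi; rewrite scale1r mul1r. Qed.

Lemma innerZr phi a psi : inner phi (a *: psi) = a * inner phi psi.
Proof. by have := innerPr phi a psi 0; rewrite addr0 innerr0 addr0. Qed.

Lemma innerBr phi psi chi : inner phi (psi - chi) = inner phi psi - inner phi chi.
Proof. by rewrite innerDr -scaleN1r innerZr mulN1r. Qed.

Lemma inner_sumr phi n (c : 'I_n -> R) (u : 'I_n -> L2 F) :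
  inner phi (\sum_(i < n) c i *: u i) = \sum_(i < n) c i * inner phi (u i).
Proof.
elim/big_rec2: _ => [|i y s _ <-]; first exact: innerr0.
by rewrite innerPr.
Qed.

Lemma eq_inner_ae phi phi' psi psi' : phi = phi' %[ae F] -> psi = psi' %[ae F] ->
  inner phi psi = inner phi' psi'.
Proof.
move=> e1 e2; congr fine; apply: ae_eq_integral => //.
- exact: (measurable_int F (inner_integrable _ _)).
- exact: (measurable_int F (inner_integrable _ _)).
by move: e1 e2; apply: filterS2 => x /(_ I) -> /(_ I) ->.
Qed.

Lemma inner_eq0 phi : inner phi phi = 0 -> phi = cst 0 %[ae F].
Proof.
move=> h; have hi := inner_integrable phi phi.
have mf := measurable_int F hi.
have : ae_eq F setT (EFin \o (fun x => phi x * phi x)) (cst 0%E).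
  apply/ae_eq_integral_abs => //.
  transitivity (\int[F]_x (phi x * phi x)%:E)%E.
    by apply: eq_integral => x _ /=; rewrite ger0_norm// -expr2 sqr_ge0.
  rewrite -[LHS]fineK; first by congr EFin; exact: h.
  exact: integrable_fin_num.
apply: filterS => x /(_ I) [] /eqP; rewrite mulf_eq0 orbb => /eqP h0 _.
exact: h0.
Qed.

(** Expressing a.e. equality through the inner product lets any map that
    preserves inner products and differences preserve it. *)
Lemma L2_ae_eqP phi psi : inner (phi - psi) (phi - psi) = 0 <-> phi = psi %[ae F].
Proof.
split=> [/inner_eq0|e].
  by apply: filterS => x /(_ I) h _; apply/subr0_eq.
rewrite (@eq_inner_ae _ 0 _ 0) ?innerr0//;
  by move: e; apply: filterS => x /(_ I) e _; apply/eqP; rewrite subr_eq0; apply/eqP.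
Qed.

End L2_inner.

(** * Orthonormal expansions *)

Section orthonormal_expansion.
Context {d} {T : measurableType d} {R : realType} (F : probability T R).
Implicit Types (phi psi p : L2 F) (M : set (L2 F)).

Lemma sum_delta (V : lmodType R) n (u : 'I_n -> V) j :
  \sum_(i < n) (i == j)%:R *: u i = u j.
Proof.
rewrite (bigD1 j)//= eqxx scale1r big1 ?addr0// => i /negPf ->.
by rewrite scale0r.
Qed.

Definition residual n (e : 'I_n -> L2 F) phi : L2 F :=
  phi - \sum_(i < n) inner (e i) phi *: e i.

Lemma residualE n (e : 'I_n -> L2 F) phi x :
  residual e phi x = phi x - \sum_(i < n) inner (e i) phi * e i x.
Proof. by rewrite -L2_sumE. Qed.

Lemma inner_residual n (e : 'I_n -> L2 F) phi j : L2_orthonormal e ->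
  inner (e j) (residual e phi) = 0.
Proof.
move=> eo; rewrite innerBr inner_sumr (bigD1 j)//= eo eqxx mulr1.
by rewrite big1 ?addr0 ?subrr// => i ij; rewrite eo eq_sym (negPf ij) mulr0.
Qed.

Lemma lspan_sum n (e : 'I_n -> L2 F) (c : 'I_n -> R) :
  lspan e (\sum_(i < n) c i *: e i).
Proof. by exists c; exact: ae_eq_refl. Qed.

Lemma lspan_gen n (e : 'I_n -> L2 F) j : lspan e (e j).
Proof. by rewrite -[X in lspan _ X](sum_delta e); exact: lspan_sum. Qed.

Lemma orth_compl_lspan n (e : 'I_n -> L2 F) p :
  (forall i, inner (e i) p = 0) -> orth_compl (lspan e) p.
Proof.
move=> ep m [c mE]; rewrite (eq_inner_ae mE (ae_eq_refl _ _ _)) innerC inner_sumr.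
by rewrite big1// => i _; rewrite innerC ep mulr0.
Qed.

(** The projector is only a choice among the admissible elements, but two of
    them differ by an element of the complement that is orthogonal to the
    whole complement, hence to itself. *)
Lemma orth_projE n (e : 'I_n -> L2 F) phi : L2_orthonormal e ->
  orth_proj (orth_compl (lspan e)) phi = residual e phi %[ae F].
Proof.
move=> eo.
have rc : orth_compl (lspan e) (residual e phi).
  by apply: orth_compl_lspan => i; exact: inner_residual.
have rm m : orth_compl (lspan e) m -> inner m (phi - residual e phi) = 0.
  by move=> mc; rewrite opprB addrC subrK innerC; apply/mc/lspan_sum.
move: (residual e phi) rc rm => r rc rm; rewrite /orth_proj; set S := [set p | _].
have [pc pm] : S (xget 0 S) by apply: (@xgetPex _ 0 S); exists r.
set p := xget 0 S in pc pm *; apply/L2_ae_eqP.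
have h m : orth_compl (lspan e) m -> inner m p = inner m r.
  by move=> mc; move: (rm m mc) (pm m mc); rewrite !innerBr; lra.
rewrite innerBr !(innerC (p - _)) !innerBr !h//; lra.
Qed.

(** Pythagoras.  The coefficients, and not the orthonormal family, determine
    the result, so exchanging the family leaves inner products unchanged. *)
Lemma inner_orth_sum n (e : 'I_n -> L2 F) p p' (c c' : 'I_n -> R) :
  L2_orthonormal e ->
  (forall i, inner (e i) p = 0) -> (forall i, inner (e i) p' = 0) ->
  inner (p + \sum_(i < n) c i *: e i) (p' + \sum_(i < n) c' i *: e i) =
  inner p p' + \sum_(i < n) c i * c' i.
Proof.
move=> eo ep ep'.
rewrite innerDr innerC innerDr inner_sumr [X in _ + X + _]big1; last first.
  by move=> i _; rewrite innerC ep' mulr0.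
rewrite addr0 innerC inner_sumr; congr (_ + _).
apply: eq_bigr => i _; rewrite innerC innerDr ep add0r inner_sumr mulrC.
congr (_ * _); rewrite (bigD1 i)//= eo eqxx mulr1 big1 ?addr0// => j ji.
by rewrite eo eq_sym (negPf ji) mulr0.
Qed.

End orthonormal_expansion.

(** * The isometry exchanging two orthonormal bases *)

Section rotation.
Context {d} {T : measurableType d} {R : realType} (F : probability T R).
Context (M : set (L2 F)) n (a b : 'I_n -> L2 F).
Hypothesis a_basis : L2_orthonormal_basis a M.
Hypothesis b_basis : L2_orthonormal_basis b M.
Implicit Types phi psi : L2 F.

(** Both residuals are the projection onto the complement of the common span. *)
Lemma residual_basis phi : residual a phi = residual b phi %[ae F].
Proof.
have [ao aM] := a_basis; have [bo bM] := b_basis.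
apply: ae_eq_trans (orth_projE phi bo).
by apply: ae_eq_sym; rewrite bM -aM; exact: orth_projE.
Qed.

Lemma Khat_residual phi :
  Khat M a b phi = residual b phi + \sum_(i < n) inner (b i) phi *: a i %[ae F].
Proof.
have [bo <-] := b_basis.
by have := orth_projE phi bo; apply: filterS => x /(_ I) h _; rewrite /Khat L2DE h.
Qed.

(** The [a i] belong to the span of [b]. *)
Lemma inner_basis_residual phi i : inner (a i) (residual b phi) = 0.
Proof.
have [ao aM] := a_basis; have [bo bM] := b_basis.
have /orth_compl_lspan : forall j, inner (b j) (residual b phi) = 0.
  by move=> j; exact: inner_residual.
by apply; rewrite bM -aM; exact: lspan_gen.
Qed.

(** The vector and its image have the same coefficients, the one in [b] and
    the other in [a], and the same component orthogonal to both families. *)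
Lemma Khat_isometry phi psi :
  inner (Khat M a b phi) (Khat M a b psi) = inner phi psi.
Proof.
have [ao _] := a_basis; have [bo _] := b_basis.
rewrite (eq_inner_ae (Khat_residual phi) (Khat_residual psi)).
rewrite inner_orth_sum//; try exact: inner_basis_residual.
rewrite -[in RHS](subrK (\sum_(i < n) inner (b i) phi *: b i) phi).
rewrite -[in RHS](subrK (\sum_(i < n) inner (b i) psi *: b i) psi).
by rewrite inner_orth_sum//; move=> i; exact: inner_residual.
Qed.

(** Writing the orthogonal component with the residual of [a] instead of [b]
    brings the two sums onto the same vectors [a i]. *)
Lemma Khat_explicit phi :
  Khat M a b phi = phi - \sum_(i < n) inner (a i - b i) phi *: a i %[ae F].
Proof.
apply: (ae_eq_trans (Khat_residual phi)).
have := residual_basis phi; apply: filterS => x /(_ I) h _.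
rewrite L2DE -h residualE L2BE !L2_sumE -addrA; congr (_ + _).
rewrite -sumrN -sumrN -big_split; apply: eq_bigr => i _ /=.
by rewrite (innerC (a i - b i)) innerBr !(innerC phi); ring.
Qed.

Lemma Khat_linear (c : R) phi psi :
  Khat M a b (c *: phi + psi) = c *: Khat M a b phi + Khat M a b psi %[ae F].
Proof.
have := Khat_explicit (c *: phi + psi).
have := Khat_explicit phi; have := Khat_explicit psi.
apply: filterS3 => x /(_ I) e1 /(_ I) e2 /(_ I) e3 _; rewrite L2PE e1 e2 e3 !L2BE L2PE.
rewrite !L2_sumE mulrBr addrACA -opprD mulr_sumr -big_split; congr (_ + - _).
by apply: eq_bigr => i _ /=; rewrite innerPr; ring.
Qed.

(** The projector inside [Khat] picks a representative, so invariance under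
    a.e. equality is read off the explicit form, where [phi] enters only
    through its values and its coefficients. *)
Lemma eq_Khat phi psi : phi = psi %[ae F] -> Khat M a b phi = Khat M a b psi %[ae F].
Proof.
move=> e; apply: (ae_eq_trans (Khat_explicit _)).
apply: (ae_eq_trans _ (ae_eq_sym (Khat_explicit _))).
apply: filterS (e) => x /(_ I) h _; rewrite !L2BE h !L2_sumE.
congr (_ - _); apply: eq_bigr => i _.
by rewrite (eq_inner_ae (ae_eq_refl _ _ _) e).
Qed.

Lemma Khat_basis i : Khat M a b (b i) = a i %[ae F].
Proof.
have [bo _] := b_basis; apply: (ae_eq_trans (Khat_residual _)).
have -> : \sum_(j < n) inner (b j) (b i) *: a j = a i.
  by rewrite -[RHS](sum_delta a); apply: eq_bigr => j _; rewrite bo.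
have -> : residual b (b i) = 0.
  apply/eqP; rewrite subr_eq0 -[eqbLHS](sum_delta b); apply/eqP.
  by apply: eq_bigr => j _; rewrite bo.
by rewrite add0r; exact: ae_eq_refl.
Qed.

End rotation.

(** [Khat M b a phi] has in [b] the coefficients that [phi] has in [a], by
    isometry; [Khat M a b] moves them back. *)
Lemma Khat_cancel {d} {T : measurableType d} {R : realType}
    (F : probability T R) (M : set (L2 F)) n (a b : 'I_n -> L2 F) phi :
  L2_orthonormal_basis a M -> L2_orthonormal_basis b M ->
  Khat M a b (Khat M b a phi) = phi %[ae F].
Proof.
move=> aM bM; set chi := Khat M b a phi.
have bchi i : inner (b i) chi = inner (a i) phi.
  rewrite -(Khat_isometry bM aM (a i)); apply: eq_inner_ae; last exact: ae_eq_refl.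
  by apply: ae_eq_sym; exact: Khat_basis.
have := Khat_residual a bM chi; have := Khat_residual b aM phi.
apply: filterS2 => x /(_ I) chiE /(_ I) -> _.
have bchiE (u : 'I_n -> L2 F) :
    \sum_(i < n) inner (b i) chi * u i x = \sum_(i < n) inner (a i) phi * u i x.
  by apply: eq_bigr => i _; rewrite bchi.
rewrite [(residual _ _ + _) x]L2DE !residualE !L2_sumE !bchiE.
by rewrite [chi x]chiE [(residual _ _ + _) x]L2DE !residualE !L2_sumE; ring.
Qed.

(** * Multiplication by the square root of the density *)

Section density.
Context {d} {T : measurableType d} {R : realType} (F G : probability T R).
Hypothesis GF : G `<< F.
Implicit Types (phi : L2 F) (psi : L2 G).

Let dG := Radon_Nikodym (charge_of_finite_measure G) F.

(** The chosen density is a derivative of charges, hence nonnegative only up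
    to a null set; it is compared with the pointwise nonnegative version. *)
Lemma sqr_sqrt_density : \forall x \ae F, (sqrt_density F G x ^+ 2)%:E = dG x.
Proof.
have := ae_eq_Radon_Nikodym_SigmaFinite GF measurableT.
apply: filterS => x /(_ I) e; rewrite /sqrt_density.
have f0 := Radon_Nikodym_SigmaFinite.f_ge0 GF x.
have ff := Radon_Nikodym_SigmaFinite.f_fin_num GF x.
by rewrite /dG -e sqr_sqrtr ?fine_ge0// fineK.
Qed.

Lemma measurable_density : measurable_fun setT dG.
Proof.
have := measurable_int F
  (Radon_Nikodym_integrable (nu := charge_of_finite_measure G) GF).
exact.
Qed.

Lemma measurable_sqrt_density : measurable_fun setT (sqrt_density F G).
Proof.
apply: (measurableT_comp (f := @Num.sqrt R)).
  by apply: continuous_measurable_fun; exact: sqrt_continuous.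
by apply: (measurableT_comp _ measurable_density); exact: fine_measurable.
Qed.

Lemma density_mulE psi x : density_mul GF psi x = sqrt_density F G x * psi x.
Proof. by []. Qed.

(** Change of variables: the two factors [l] multiply to the density. *)
Lemma density_mul_isometry psi psi' :
  inner (density_mul GF psi) (density_mul GF psi') = inner psi psi'.
Proof.
congr fine; rewrite -(Radon_Nikodym_change_of_variables GF measurableT
  (inner_integrable psi psi')).
have ml := measurable_sqrt_density.
apply: ae_eq_integral => //.
- exact: (measurable_int F (inner_integrable _ _)).
- apply: emeasurable_funM; first exact: (measurable_int G (inner_integrable _ _)).
  exact: measurable_density.
apply: filterS sqr_sqrt_density => x e _ /=; rewrite -/dG -e -EFinM.
by congr EFin; ring.
Qed.

Lemma density_mul_linear (c : R) psi psi' :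
  density_mul GF (c *: psi + psi') =
    c *: density_mul GF psi + density_mul GF psi' %[ae F].
Proof. by apply: aeW => x _; rewrite L2PE !density_mulE L2PE; ring. Qed.

(** A function that vanishes [G]-a.e. may be nonzero on a set of positive
    [F]-measure; there [l] vanishes, because the isometry gives the product
    norm zero. *)
Lemma eq_density_mul psi psi' : psi = psi' %[ae G] ->
  density_mul GF psi = density_mul GF psi' %[ae F].
Proof.
move=> /L2_ae_eqP e; apply/L2_ae_eqP; rewrite -[RHS]e -density_mul_isometry.
by apply: eq_inner_ae; apply: aeW => x _; rewrite L2BE !density_mulE L2BE; ring.
Qed.

(** [G] gives measure zero to the zero set of its density. *)
Lemma sqrt_density_neq0 : F `<< G -> \forall x \ae F, sqrt_density F G x != 0.
Proof.
move=> FG; set N := sqrt_density F G @^-1` [set 0].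
have mN : measurable N.
  by rewrite -[N]setTI; apply: measurable_sqrt_density => //; exact: measurable_set1.
have GN : G N = 0.
  have := Radon_Nikodym_integral (nu := charge_of_finite_measure G) GF mN.
  rewrite -/dG => /= ->.
  rewrite (ae_eq_integral (cst 0%E)) ?integral0//.
    exact/measurable_funTS/measurable_density.
  by apply: filterS sqr_sqrt_density => x + lx; rewrite -/dG lx expr0n.
exists N; split => //.
  by apply: (measure0_null_setP F mN).1; apply: FG; apply/measure0_null_setP.
by move=> x /= /negP; rewrite negbK => /eqP.
Qed.

(** The preimage is [phi / l]: its square integrates to the same value under
    [G] as the square of [phi] under [F]. *)
Lemma density_mul_surj phi : F `<< G ->
  exists psi, density_mul GF psi = phi %[ae F].
Proof.
move=> FG; pose u x := phi x / sqrt_density F G x.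
have ml := measurable_sqrt_density.
have mphi : measurable_fun setT phi by [].
have meas_u : measurable_fun setT u.
  apply: measurable_funM => //.
  (* the power -1 is a measurable function and agrees with the inverse on
     nonnegative numbers, including zero *)
  under eq_fun do rewrite -powR_inv1 ?sqrtr_ge0//.
  exact: (measurableT_comp (measurable_powR _) ml).
have ulE : \forall x \ae F, u x ^+ 2 * sqrt_density F G x ^+ 2 = phi x ^+ 2.
  apply: filterS (sqrt_density_neq0 FG) => x lx.
  by rewrite -exprMn divfK.
have meas_u2 : measurable_fun setT (EFin \o (fun x => u x ^+ 2)).
  by apply/measurable_EFinP; exact: measurable_funX.
have u2 : (\int[G]_x (u x ^+ 2)%:E < +oo)%E.
  have phi2 : F.-integrable setT (EFin \o (fun x => phi x ^+ 2)).
    exact/Lfun2_integrable_sqr/LfunP.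
  rewrite -(Radon_Nikodym_SigmaFinite.change_of_variables GF)//; last first.
    by move=> x; rewrite lee_fin sqr_ge0.
  rewrite (ae_eq_integral (EFin \o (fun x => phi x ^+ 2)))//.
  - exact: integrable_lty.
  - apply: emeasurable_funM => //.
    exact: measurable_int (Radon_Nikodym_SigmaFinite.f_integrable GF).
  - exact: measurable_int phi2.
  have := ae_eq_Radon_Nikodym_SigmaFinite GF measurableT.
  have := sqr_sqrt_density; move: ulE; apply: filterS3 => x ul e /(_ I) -> _ /=.
  by rewrite -/dG -e -EFinM ul.
have uL2 : u \in Lfun G 2%:E.
  apply/andP; split; first by rewrite inE.
  rewrite inE/= /finite_norm unlock poweR_lty//.
  rewrite (eq_integral (fun x => (u x ^+ 2)%:E))// => x _ /=.
  by rewrite powR_mulrn// real_normK ?num_real.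
exists (Lfun_Sub (lee1n 2) uL2).
apply: filterS (sqrt_density_neq0 FG) => x lx _.
by rewrite density_mulE /= /u mulrC divfK.
Qed.

End density.

(** * Almost sure relations and finite-dimensional laws *)

Section finite_dimensional_laws.
Context {R : realType}.

Lemma RV_PE {dO} {O : measurableType dO} (P : probability O R) (a : R)
    (X Y : {RV P >-> R}) o :
  (a *: (X : {mfun O >-> R}) + (Y : {mfun O >-> R}) : {mfun O >-> R}) o =
    a * X o + Y o.
Proof. by []. Qed.

Lemma RV_sumE {dO} {O : measurableType dO} (P : probability O R) n
    (c : 'I_n -> R) (X : 'I_n -> {RV P >-> R}) o :
  (\sum_(i < n) c i *: (X i : {mfun O >-> R})) o = \sum_(i < n) c i * X i o.
Proof. by elim/big_rec2: _ => // i y s _ <-. Qed.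

Lemma measurable_fdd_event {dO} {O : measurableType dO} (P : probability O R)
    (J : Type) (X : J -> {RV P >-> R}) n (i : 'I_n -> J) (A : set (n.-tuple R)) :
  measurable A -> measurable [set o | A [tuple X (i k) o | k < n]].
Proof.
move=> mA; rewrite -[X in measurable X]setTI.
suff mt : measurable_fun setT (fun o => [tuple X (i k) o | k < n]) by exact: mt.
apply/measurable_fun_tnthP => k; rewrite (_ : _ \o _ = X (i k))//.
by apply/funext => o /=; rewrite tnth_mktuple.
Qed.

Lemma eq_measure_ae {d} {T : measurableType d} (mu : {measure set T -> \bar R})
    (A B : set T) : measurable A -> measurable B ->
  (\forall x \ae mu, A x <-> B x) -> mu A = mu B.
Proof.
move=> mA mB [N [mN N0 AB]].
have le (C E : set T) : measurable C -> measurable E ->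
    (forall x, ~ N x -> C x -> E x) -> (mu C <= mu E)%E.
  move=> mC mE CE; rewrite -[leRHS]adde0 -[X in (_ <= _ + X)%E]N0.
  apply: (le_trans _ (measureU2 mu mE mN)); apply: le_measure.
  - by rewrite inE.
  - by rewrite inE; exact: measurableU.
  by move=> x Cx; have [Nx|nNx] := pselect (N x); [right|left; exact: CE].
have AB' x : ~ N x -> (A x <-> B x).
  by move=> nNx; apply: contrapT => nAB; apply: nNx; exact: AB.
by apply/eqP; rewrite eq_le !le// => x /AB' [].
Qed.

Lemma ae_same_fdd {dO} {O : measurableType dO} (P : probability O R) (J : Type)
    (X Y : J -> {RV P >-> R}) :
  (forall i, X i = Y i %[ae P]) -> same_fdd X Y.
Proof.
move=> XY n i A mA; apply: eq_measure_ae.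
- exact: (measurable_fdd_event X i mA).
- exact: (measurable_fdd_event Y i mA).
have : \forall o \ae P, forall k, X (i k) o = Y (i k) o.
  apply: (@filter_forall _ _ (fun k o => X (i k) o = Y (i k) o)) => k.
  by have := XY (i k); apply: filterS => o /(_ I).
by apply: filterS => o XYo /=; under eq_mktuple do rewrite XYo.
Qed.

Lemma same_fdd_trans {d1} {O1 : measurableType d1} {d2} {O2 : measurableType d2}
    {d3} {O3 : measurableType d3} (P1 : probability O1 R) (P2 : probability O2 R)
    (P3 : probability O3 R) (J : Type) (X1 : J -> {RV P1 >-> R})
    (X2 : J -> {RV P2 >-> R}) (X3 : J -> {RV P3 >-> R}) :
  same_fdd X1 X2 -> same_fdd X2 X3 -> same_fdd X1 X3.
Proof. by move=> h h' n i A mA; rewrite h// h'. Qed.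

(** An almost sure linear relation between finitely many coordinates is the
    statement that a certain measurable event has probability zero. *)
Lemma same_fdd_lincomb0 {d1} {O1 : measurableType d1}
    {d2} {O2 : measurableType d2} (P1 : probability O1 R) (P2 : probability O2 R)
    (J : Type) (X1 : J -> {RV P1 >-> R}) (X2 : J -> {RV P2 >-> R})
    (s : seq (R * J)) : same_fdd X1 X2 ->
  (\forall o \ae P2, \sum_(p <- s) p.1 * X2 p.2 o = 0) ->
  (\forall o \ae P1, \sum_(p <- s) p.1 * X1 p.2 o = 0).
Proof.
move=> X12 X20; set n := size s.
pose c (k : 'I_n) := (tnth (in_tuple s) k).1.
pose i (k : 'I_n) := (tnth (in_tuple s) k).2.
pose f (t : n.-tuple R) := \sum_(k < n) c k * tnth t k.
have mA : measurable (~` (f @^-1` [set 0])).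
  apply: measurableC; rewrite -[X in measurable X]setTI.
  suff mf : measurable_fun setT f by apply: mf => //; exact: measurable_set1.
  apply: measurable_sum => k; apply: measurable_funM => //.
  exact: measurable_tnth.
have fE d (O : measurableType d) (P : probability O R) (X : J -> {RV P >-> R}) :
    [set o | (~` (f @^-1` [set 0])) [tuple X (i k) o | k < n]] =
    ~` [set o | \sum_(p <- s) p.1 * X p.2 o = 0].
  apply/funext => o; rewrite /setC /preimage /=; congr (~ (_ = _)).
  by rewrite big_tnth; apply: eq_bigr => k _; rewrite tnth_mktuple.
have := X12 n i _ mA; have := measurable_fdd_event X1 i mA.
have := measurable_fdd_event X2 i mA; rewrite !fE => m2 m1 e.
by apply/negligibleP => //; apply: (etrans e); apply/negligibleP.
Qed.

End finite_dimensional_laws.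

(** * Pinned linear processes *)

Section linear_processes.
Context {R : realType} {d} {T : measurableType d} (F : probability T R).
Context {dO} {O : measurableType dO} (P : probability O R).
Implicit Types (v w : L2 F -> {RV P >-> R}) (phi psi : L2 F).

Lemma L2_linear_sub_sum v phi n (c : 'I_n -> R) (u : 'I_n -> L2 F) :
  L2_linear v -> \forall o \ae P,
    v (phi - \sum_(i < n) c i *: u i) o = v phi o - \sum_(i < n) c i * v (u i) o.
Proof.
move=> [_ vl]; elim: (index_enum _) => [|i s ih].
  by apply: aeW => o; rewrite !big_nil !subr0.
rewrite big_cons opprD addrCA -scaleNr.
have := vl (- c i) (u i) (phi - \sum_(j <- s) c j *: u j).
move: ih; apply: filterS2 => o e /(_ I) ->.
by rewrite big_cons RV_PE e; ring.
Qed.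

Lemma projectionE n (q : 'I_n -> L2 F) w phi o :
  projection q w phi o = w phi o - \sum_(i < n) inner (q i) phi * w (q i) o.
Proof. by rewrite -RV_sumE. Qed.

Lemma projection_pinned n (q : 'I_n -> L2 F) w : L2_orthonormal q ->
  L2_linear w -> pinned_linear q (projection q w).
Proof.
move=> qo [weq wl]; split; first split.
- move=> phi psi e; apply: filterS (weq _ _ e) => o /(_ I) wo _.
  rewrite !projectionE wo; congr (_ - _); apply: eq_bigr => i _.
  by rewrite (eq_inner_ae (ae_eq_refl _ _ _) e).
- move=> a phi psi; apply: filterS (wl a phi psi) => o /(_ I) wo _.
  rewrite RV_PE !projectionE wo RV_PE.
  rewrite mulrBr addrACA -opprD mulr_sumr -big_split; congr (_ - _).
  by apply: eq_bigr => i _ /=; rewrite innerPr; ring.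
- move=> j; apply: aeW => o _; rewrite projectionE (bigD1 j)//= qo eqxx mul1r.
  by rewrite big1 ?addr0 ?subrr// => i /negPf ij; rewrite qo ij mul0r.
Qed.

End linear_processes.

Section transfer.
Context {R : realType} {d} {T : measurableType d} (F : probability T R).
Context {dO} {O : measurableType dO} (P : probability O R).
Context {dO'} {O' : measurableType dO'} (P' : probability O' R).

(** Each clause is the vanishing of a linear combination of at most three
    coordinates. *)
Lemma same_fdd_pinned n (q : 'I_n -> L2 F) (v : L2 F -> {RV P >-> R})
    (w : L2 F -> {RV P' >-> R}) :
  same_fdd v w -> pinned_linear q w -> pinned_linear q v.
Proof.
move=> vw [[weq wl] w0].
have transfer (s : seq (R * L2 F)) := same_fdd_lincomb0 (s := s) vw.
split; first split.
- move=> phi psi e.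
  have := transfer [:: (1, phi); (-1, psi)].
  have h : \forall o \ae P', \sum_(p <- [:: (1, phi); (-1, psi)]) p.1 * w p.2 o = 0.
    apply: filterS (weq _ _ e) => o /(_ I) wo.
    by rewrite !big_cons big_nil /= wo; ring.
  move=> /(_ h); apply: filterS => o.
  by rewrite !big_cons big_nil /= => vo _; lra.
- move=> a phi psi.
  set s := [:: (1, a *: phi + psi); (- a, phi); (-1, psi)].
  have h : \forall o \ae P', \sum_(p <- s) p.1 * w p.2 o = 0.
    apply: filterS (wl a phi psi) => o /(_ I) wo.
    by rewrite !big_cons big_nil [w (_, _).2 o]wo RV_PE /=; ring.
  have := transfer s h; apply: filterS => o.
  by rewrite !big_cons big_nil RV_PE /= => vo _; lra.
- move=> j.
  have h : \forall o \ae P', \sum_(p <- [:: (1, q j)]) p.1 * w p.2 o = 0.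
    by apply: filterS (w0 j) => o /(_ I) wo; rewrite big_seq1 wo mulr0.
  by have := transfer _ h; apply: filterS => o; rewrite big_seq1 mul1r.
Qed.

End transfer.

Lemma projected_brownian_pinned {R : realType} {d} {T : measurableType d}
    (F : probability T R) {dO} {O : measurableType dO} (P : probability O R)
    n (q : 'I_n -> L2 F) (v : L2 F -> {RV P >-> R}) :
  L2_orthonormal q -> projected_brownian_motion q v -> pinned_linear q v.
Proof.
move=> qo [dS [S [Q [w [[_ _ wl _] vw]]]]].
by apply: (same_fdd_pinned vw); exact: projection_pinned.
Qed.

(** * Transport along an isometry *)

Section isometric_transport.
Context {R : realType} {d} {T : measurableType d} (F G : probability T R).
Variable U : L2 G -> L2 F.
Hypothesis U_inner : forall psi psi', inner (U psi) (U psi') = inner psi psi'.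
Hypothesis U_eq : forall psi psi' : L2 G, psi = psi' %[ae G] -> U psi = U psi' %[ae F].
Hypothesis U_linear : forall (a : R) (psi psi' : L2 G),
  U (a *: psi + psi') = a *: U psi + U psi' %[ae F].
Context {dO} {O : measurableType dO} (P : probability O R).

(** Centering and joint Gaussianity are inherited by any subfamily; only the
    covariance and the linearity depend on the properties of [U]. *)
Lemma brownian_motion_transport (w : L2 F -> {RV P >-> R}) :
  brownian_motion w -> brownian_motion (fun psi => w (U psi)).
Proof.
move=> [wg w0 [weq wl] wc]; split.
- by move=> n i c; exact: (wg n (fun k => U (i k)) c).
- by move=> psi.
- split=> [psi psi' e|a psi psi']; first exact/weq/U_eq.
  exact: (ae_eq_trans (weq _ _ (U_linear a psi psi')) (wl a _ _)).
- by move=> psi psi'; rewrite wc U_inner.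
Qed.

(** The coefficients agree by isometry and the vectors by [U (r i) = q i]. *)
Lemma projection_transport n (q : 'I_n -> L2 F) (r : 'I_n -> L2 G)
    (w : L2 F -> {RV P >-> R}) psi :
  L2_linear w -> (forall i, U (r i) = q i %[ae F]) ->
  projection q w (U psi) = projection r (fun psi' => w (U psi')) psi %[ae P].
Proof.
move=> [weq _] Ur.
have : \forall o \ae P, forall i, w (U (r i)) o = w (q i) o.
  apply: (@filter_forall _ _ (fun i o => w (U (r i)) o = w (q i) o)) => i.
  by have := weq _ _ (Ur i); apply: filterS => o /(_ I).
apply: filterS => o wo _; rewrite !projectionE; congr (_ - _).
apply: eq_bigr => i _; rewrite wo -(U_inner (r i)).
by congr (_ * _); apply: eq_inner_ae; [exact: ae_eq_sym (Ur i)|exact: ae_eq_refl].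
Qed.

(** The witness is the Brownian motion [w o U] on the space that carries [w],
    since [v] is only known to share its laws with the projection of [w]. *)
Lemma projected_brownian_transport n (q : 'I_n -> L2 F) (r : 'I_n -> L2 G)
    {dO'} {O' : measurableType dO'} (P' : probability O' R)
    (v : L2 F -> {RV P' >-> R}) (w : L2 F -> {RV P >-> R}) :
  (forall i, U (r i) = q i %[ae F]) -> brownian_motion w ->
  same_fdd v (projection q w) ->
  projected_brownian_motion r (fun psi => v (U psi)).
Proof.
move=> Ur wB vw; exists dO, O, P, (fun psi => w (U psi)); split.
  exact: brownian_motion_transport.
apply: (@same_fdd_trans _ _ _ _ _ _ _ _ _ _ _ _ (fun psi => projection q w (U psi))).
  by move=> m i A mA; exact: (vw m (fun k => U (i k)) A mA).
apply: ae_same_fdd => psi.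
by apply: projection_transport => //; have [] := wB.
Qed.

End isometric_transport.

(** * The explicit form and injectivity *)

Section transform_properties.
Context {R : realType} {d} {T : measurableType d} (F G : probability T R).
Hypothesis GF : G `<< F.
Context {dO} {O : measurableType dO} (P : probability O R).
Variable M : set (L2 F).

Lemma transform_explicit k (q : 'I_k -> L2 F) (a b : 'I_(k + k) -> L2 F)
    (v : L2 F -> {RV P >-> R}) psi :
  L2_orthonormal_basis a M -> L2_orthonormal_basis b M ->
  (forall i, a (lshift k i) = q i %[ae F]) -> pinned_linear q v ->
  transform GF M a b v psi = explicit_transform GF a b v psi %[ae P].
Proof.
move=> aM bM aq [vl vq]; have [veq _] := vl.
set phi := density_mul GF psi.
have va : \forall o \ae P, forall i, v (a (lshift k i)) o = 0.
  apply: (@filter_forall _ _ (fun i o => v (a (lshift k i)) o = 0)) => i.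
  have := veq _ _ (aq i); have := vq i.
  by apply: filterS2 => o /(_ I) vqo /(_ I) ->.
have := veq _ _ (Khat_explicit aM bM phi).
have := L2_linear_sub_sum phi (fun i => inner (a i - b i) phi) a vl.
move: va; apply: filterS3 => o va vs /(_ I) vK _.
rewrite /transform -/phi vK vs big_split_ord big1/= ?add0r; last first.
  by move=> i _; rewrite va mulr0.
under eq_bigr do rewrite innerC.
by rewrite -(RV_sumE _ (fun j => v (a (rshift k j)))).
Qed.

(** Every [phi] is attained: take [psi] with [l psi = Khat M b a phi]. *)
Lemma transform_inj n (a b : 'I_n -> L2 F) (v v' : L2 F -> {RV P >-> R}) :
  L2_orthonormal_basis a M -> L2_orthonormal_basis b M -> F `<< G ->
  L2_linear v -> L2_linear v' ->
  (forall psi, transform GF M a b v psi = transform GF M a b v' psi %[ae P]) ->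
  forall phi, v phi = v' phi %[ae P].
Proof.
move=> aM bM FG [veq _] [veq' _] vv' phi.
have [psi psiE] := density_mul_surj GF (Khat M b a phi) FG.
have KE : Khat M a b (density_mul GF psi) = phi %[ae F].
  exact: (ae_eq_trans (eq_Khat aM bM psiE) (Khat_cancel phi aM bM)).
apply: (ae_eq_trans (ae_eq_sym (veq _ _ KE))).
exact: (ae_eq_trans (vv' psi) (veq' _ _ KE)).
Qed.

End transform_properties.

Theorem theorem7 (R : realType) (d kappa : nat)
    (F G : probability (d.-tuple R) R) (GF : G `<< F)
    (q : 'I_kappa.+1 -> L2 F) (r : 'I_kappa.+1 -> L2 G)
    (q0 : q ord0 = cst 1 %[ae F]) (r0 : r ord0 = cst 1 %[ae G])
    (q_on : L2_orthonormal q) (r_on : L2_orthonormal r)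
    (indep : lin_indep (joint_family GF q r))
    (a b : 'I_(kappa.+1 + kappa.+1) -> L2 F)
    (a_basis : L2_orthonormal_basis a (lspan (joint_family GF q r)))
    (b_basis : L2_orthonormal_basis b (lspan (joint_family GF q r)))
    (a_q : forall i : 'I_kappa.+1, a (lshift kappa.+1 i) = q i %[ae F])
    (b_lr : forall i : 'I_kappa.+1,
       b (lshift kappa.+1 i) = density_mul GF (r i) %[ae F]) :
  let Lhat := lspan (joint_family GF q r) in
  (forall (dO : measure_display) (O : measurableType dO) (P : probability O R)
     (vF : L2 F -> {RV P >-> R}),
     projected_brownian_motion q vF ->
     projected_brownian_motion r (transform GF Lhat a b vF) /\
     (forall psi : L2 G,
        transform GF Lhat a b vF psi = explicit_transform GF a b vF psi
          %[ae P])) /\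
  (F `<< G ->
   forall (dO : measure_display) (O : measurableType dO) (P : probability O R)
     (v v' : L2 F -> {RV P >-> R}),
     pinned_linear q v -> pinned_linear q v' ->
     (forall psi : L2 G,
        transform GF Lhat a b v psi = transform GF Lhat a b v' psi
          %[ae P]) ->
     forall phi : L2 F, v phi = v' phi %[ae P]).
Proof.
move=> Lhat; split; last first.
  move=> FG dO O P v v' [vl _] [vl' _]; exact: transform_inj.
move=> dO O P vF vFB; split; last first.
  move=> psi; apply: (transform_explicit _ _ a_basis b_basis a_q).
  exact: projected_brownian_pinned.
have [dS [S [Q [w [wB vFw]]]]] := vFB.
apply: (projected_brownian_transport _ _ _ _ wB vFw).
- move=> psi psi'.
  by rewrite (Khat_isometry a_basis b_basis) density_mul_isometry.
- by move=> psi psi' e; apply: (eq_Khat a_basis b_basis); exact: eq_density_mul.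
- move=> c psi psi'.
  apply: (ae_eq_trans (eq_Khat a_basis b_basis (density_mul_linear GF c psi psi'))).
  exact: Khat_linear.
- move=> i; apply: (ae_eq_trans (eq_Khat a_basis b_basis (ae_eq_sym (b_lr i)))).
  exact: (ae_eq_trans (Khat_basis a b_basis _) (a_q i)).
Qed.
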